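(* If the law $\mathbb{P}_{\boldsymbol{w}}$ of the disturbance is log-concave and $\mathcal{O}(\overline{0})$ is convex, then for every $\tau\in\{1,\dots,N\}$ the probabilistic occupancy function $\overline{y}\mapsto\phi_{\boldsymbol{x}}(\overline{y};\tau)$ is log-concave on $\mathbb{R}^n$. Moreover, the set $\mathrm{PrOccupySet}_P(\alpha;\tau)=\{\overline{y}\in\mathbb{R}^n:\phi_{\boldsymbol{x}}(\overline{y};\tau)\ge\alpha\}$ is convex for every $\alpha\in\mathbb{R}$.
   Context: DPV system (discrete-time affine parameter-varying stochastic system). Fix $N,n,m,p,l\ge 1$, a finite set $\mathcal{P}\subset\mathbb{R}^l$ and maps $A:\mathcal{P}\to\mathbb{R}^{n\times n}$, $B:\mathcal{P}\to\mathbb{R}^{n\times m}$, $F:\mathcal{P}\to\mathbb{R}^{n\times p}$. For $t=0,\dots,N-1$, $$\boldsymbol{x}_{t+1}=A(\overline\lambda_t)\boldsymbol{x}_t+B(\overline\lambda_t)\overline{u}_t+F(\overline\lambda_t)\boldsymbol{w}_t,$$ where $\boldsymbol{x}_0=\overline{x}_0\in\mathbb{R}^n$, the parameters $\overline\lambda_t\in\mathcal{P}$ and the inputs $\overline{u}_t\in\mathbb{R}^m$ are known and deterministic, and $\boldsymbol{w}_0,\dots,\boldsymbol{w}_{N-1}$ are IID random vectors in $\mathbb{R}^p$ with law $\mathbb{P}_{\boldsymbol{w}}$ having a density. Obstacle: let $h_{\mathrm{obs}}:\mathbb{R}^n\to\mathbb{R}$ be Borel and $\mathcal{O}(\overline{c})=\{\overline{z}\in\mathbb{R}^n:h_{\mathrm{obs}}(\overline{z}-\overline{c})\ge0\}$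 for $\overline{c}\in\mathbb{R}^n$; the shape $\mathcal{O}(\overline{0})$ is a Borel set of non-zero Lebesgue measure. The probabilistic occupancy function is $$\phi_{\boldsymbol{x}}(\overline{y};\tau)=\mathbb{P}\{\boldsymbol{x}_\tau\in\{\overline{z}\in\mathbb{R}^n:\overline{y}\in\mathcal{O}(\overline{z})\}\}.$$ A probability measure $\mathbb{P}$ is log-concave if for all (non-empty) convex Borel sets $\mathcal{G}_A,\mathcal{G}_B$ and $\zeta\in[0,1]$, $\mathbb{P}(\zeta\mathcal{G}_A\oplus(1-\zeta)\mathcal{G}_B)\ge\mathbb{P}(\mathcal{G}_A)^\zeta\,\mathbb{P}(\mathcal{G}_B)^{1-\zeta}$, where $\oplus$ is the Minkowski sum. A non-negative function $f$ is log-concave if $\log f$ is concave (with $\log 0=-\infty$). *)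

(* Defs.v *)
From HB Require Import structures.
From mathcomp Require Import all_boot all_order all_algebra.
From mathcomp Require Import all_classical all_reals all_analysis.
From mathcomp Require Import measurable_realfun.

Set Implicit Arguments.
Unset Strict Implicit.
Unset Printing Implicit Defensive.

Import Order.TTheory GRing.Theory Num.Theory.
Import numFieldNormedType.Exports.

Local Open Scope classical_set_scope.
Local Open Scope ring_scope.

(* R^n is 'cV[R]_n; its measurable sets are the Borel sets of the topology
   of the max norm. *)
Definition borel_mx (R : realType) (m n : nat) : set (set 'M[R]_(m, n)) :=
  <<s (open : set_system 'M[R]_(m, n)) >>.

HB.instance Definition _ (R : realType) (m n : nat) :=
  @isMeasurable.Build default_measure_display 'M[R]_(m, n) (@borel_mx R m n)
    (@sigma_algebra0 _ setT _) (@sigma_algebraC _ _)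
    (@sigma_algebra_bigcup _ setT _).

Section borel_matrix.
Context (R : realType) (m n : nat).

Lemma measurable_mxE :
  @measurable _ 'M[R]_(m, n) = <<s (open : set_system 'M[R]_(m, n)) >>.
Proof. by []. Qed.

Lemma measurable_mx_coord (i : 'I_m) (j : 'I_n) :
  measurable_fun [set: 'M[R]_(m, n)] (fun M : 'M[R]_(m, n) => M i j).
Proof.
apply: (measurability _ (RGenOpens.measurableE R)).
move=> _ [_ [a [b ->]] <-]; rewrite setTI; apply: sub_sigma_algebra.
have /continuousP := @coord_continuous R m n i j.
by apply; exact: interval_open.
Qed.

Let box (q : {ffun 'I_m * 'I_n -> rat * rat}) : set 'M[R]_(m, n) :=
  [set M | forall i j, M i j \in `](ratr (q (i, j)).1), (ratr (q (i, j)).2)[].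

Let open_bigcup_box (U : set 'M[R]_(m, n)) : open U ->
  U = \bigcup_q (if `[< box q `<=` U >] then box q else set0).
Proof.
move=> oU; apply/seteqP; split=> [M UM|M [q _]]; last first.
  by case: asboolP => // + bM; exact.
have /nbhs_ballP[e /= e0 eU] : nbhs M U by exact: open_nbhs_nbhs.
have /choice[q qP] (ij : 'I_m * 'I_n) : exists q : rat * rat,
    [/\ ratr q.1 \in `](M ij.1 ij.2 - e), (M ij.1 ij.2)[ &
        ratr q.2 \in `](M ij.1 ij.2), (M ij.1 ij.2 + e)[].
  have [a aP] : exists a : rat, ratr a \in `](M ij.1 ij.2 - e), (M ij.1 ij.2)[.
    by apply: rat_in_itvoo; rewrite ltrBlDr ltrDl.
  have [b bP] : exists b : rat, ratr b \in `](M ij.1 ij.2), (M ij.1 ij.2 + e)[.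
    by apply: rat_in_itvoo; rewrite ltrDl.
  by exists (a, b).
exists [ffun ij => q ij] => //; case: asboolP => [_ i j|].
  rewrite ffunE; have [/= qa qb] := qP (i, j).
  by move: qa qb; rewrite !in_itv/= => /andP[_ ->] /andP[->].
case=> N /= qN; apply: eU; split => // i j; rewrite /ball/=.
have := qN i j; rewrite ffunE; have [/= qa qb] := qP (i, j).
move: qa qb; rewrite !in_itv/= => /andP[qa _] /andP[_ qb] /andP[qN1 qN2].
by rewrite distrC ltr_distl (lt_trans qa qN1) (lt_trans qN2 qb).
Qed.

Lemma measurable_fun_mxP d (T : measurableType d) (f : T -> 'M[R]_(m, n)) :
  measurable_fun [set: T] f <->
  forall i j, measurable_fun [set: T] (fun t => f t i j).
Proof.
split=> [mf i j|mf].
  by apply: (measurableT_comp (measurable_mx_coord i j)).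
apply: (measurability _ measurable_mxE).
move=> _ [U oU <-]; rewrite setTI (open_bigcup_box oU) preimage_bigcup.
apply: countable_bigcupT_measurable => [|q]; first exact: countableP.
case: asboolP => _; last by rewrite preimage_set0.
rewrite (_ : f @^-1` _ = \bigcap_(i : 'I_m) \bigcap_(j : 'I_n)
   ((fun t => f t i j) @^-1`
     [set` `](ratr (q (i, j)).1), (ratr (q (i, j)).2)[ : interval R])); last first.
  apply/seteqP; split=> [t tq i _ j _|t tq i j]; first exact: tq.
  exact: (tq i Logic.I j Logic.I).
apply: fin_bigcap_measurable => // i _; apply: fin_bigcap_measurable => // j _.
by rewrite -[X in measurable X]setTI; apply: mf.
Qed.

End borel_matrix.

(* Lebesgue measure on R^n, by recursion on n: R^0 is a point of mass 1, and
   the measure on R^(1+n) is the product of the Lebesgue measure on R with the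
   one on R^n, transported along (r, v) |-> (r, v_1, ..., v_n). *)
Section lebesgue_cV.
Context (R : realType).

Definition cV_cons n (p : measurableTypeR R * 'cV[R]_n) : 'cV[R]_n.+1 :=
  col_mx (p.1 : R)%:M p.2.

Definition cV_uncons n (v : 'cV[R]_n.+1) : measurableTypeR R * 'cV[R]_n :=
  (v ord0 ord0, dsubmx (v : 'cV[R]_(1 + n))).

Lemma cV_consK n : cancel (@cV_cons n) (@cV_uncons n).
Proof.
case=> r v; congr (_, _); last exact: col_mxKd.
transitivity (col_mx (r : R)%:M v (lshift n ord0) ord0); last first.
  by rewrite col_mxEu mxE eqxx mulr1n.
by congr (col_mx _ _ _ _); exact/val_inj.
Qed.

Lemma measurable_cV_cons n : measurable_fun setT (@cV_cons n).
Proof.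
apply/(measurable_fun_mxP (m := 1 + n)) => i j; case: (split_ordP i) => k ->.
  rewrite (_ : (fun _ => _) = fst); first exact: measurable_fst.
  by apply/funext => p; rewrite /cV_cons col_mxEu !ord1 mxE eqxx mulr1n.
rewrite (_ : (fun _ => _) = (fun M : 'cV[R]_n => M k j) \o snd).
  by apply: measurableT_comp; [exact: measurable_mx_coord|exact: measurable_snd].
by apply/funext => p; rewrite /cV_cons col_mxEd.
Qed.

Lemma measurable_cV_uncons n : measurable_fun setT (@cV_uncons n).
Proof.
apply/measurable_fun_pairP; split; first exact: measurable_mx_coord.
apply/measurable_fun_mxP => i j; under eq_fun do rewrite /= mxE.
exact: measurable_mx_coord.
Qed.

Section step.
Variables (n : nat) (mu : {sigma_finite_measure set 'cV[R]_n -> \bar R}).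

Definition lebesgue_cV_step : set 'cV[R]_n.+1 -> \bar R :=
  pushforward (lebesgue_measure \x mu)%E
    (@cV_cons n).

Let mcons A : measurable A -> measurable (@cV_cons n @^-1` A).
Proof.
by move=> mA; rewrite -[X in measurable X]setTI; exact: measurable_cV_cons.
Qed.

Let step0 : lebesgue_cV_step set0 = 0%E.
Proof. by rewrite /lebesgue_cV_step /pushforward preimage_set0 measure0. Qed.

Let step_ge0 A : (0 <= lebesgue_cV_step A)%E.
Proof. by rewrite /lebesgue_cV_step /pushforward; apply: measure_ge0. Qed.

Let step_sigma_additive : semi_sigma_additive lebesgue_cV_step.
Proof.
move=> F mF tF mUF; rewrite /lebesgue_cV_step /pushforward preimage_bigcup.
apply: measure_semi_sigma_additive.
- by move=> k; exact: mcons.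
- apply/trivIsetP => i j _ _ ij; rewrite -preimage_setI.
  by move/trivIsetP : tF => /(_ _ _ _ _ ij) ->//; rewrite preimage_set0.
- by rewrite -preimage_bigcup; exact: mcons.
Qed.

HB.instance Definition _ := isMeasure.Build _ _ _ lebesgue_cV_step
  step0 step_ge0 step_sigma_additive.

Let sigma_finite_step : sigma_finite setT lebesgue_cV_step.
Proof.
have /sigma_finiteP[F [FT ndF Foo]] :=
  sigma_finiteT (@lebesgue_measure R : {sigma_finite_measure set _ -> \bar R}).
have /sigma_finiteP[G [GT ndG Goo]] := sigma_finiteT mu.
have preFG k : @cV_cons n @^-1` (@cV_uncons n @^-1` (F k `*` G k)) = F k `*` G k.
  by apply/funext => x; rewrite /preimage /mkset cV_consK.
exists (fun k => @cV_uncons n @^-1` (F k `*` G k)).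
  apply/seteqP; split=> // v _.
  have [k _ Fk] : (\bigcup_k F k) (cV_uncons v).1 by rewrite -FT.
  have [l _ Gl] : (\bigcup_k G k) (cV_uncons v).2 by rewrite -GT.
  exists (maxn k l) => //; split => /=.
    by move: Fk; exact/subsetPset/ndF/leq_maxl.
  by move: Gl; exact/subsetPset/ndG/leq_maxr.
move=> k; have [mF Fk] := Foo k; have [mG Gk] := Goo k; split.
  rewrite -[X in measurable X]setTI; apply: measurable_cV_uncons => //.
  exact: measurableX.
rewrite /lebesgue_cV_step /pushforward preFG product_measure1E//.
by rewrite lte_mul_pinfty// ge0_fin_numE.
Qed.

HB.instance Definition _ :=
  Measure_isSigmaFinite.Build _ _ _ lebesgue_cV_step sigma_finite_step.

End step.

Fixpoint lebesgue_cV (n : nat) : {sigma_finite_measure set 'cV[R]_n -> \bar R} :=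
  if n is n'.+1 then lebesgue_cV_step (lebesgue_cV n')
  else dirac (0 : 'cV[R]_0).

End lebesgue_cV.

Lemma lebesgue_cV_box (R : realType) n (A : 'I_n -> set R) :
  (forall i, measurable (A i)) ->
  lebesgue_cV R n [set v | forall i, A i (v i ord0)] =
  (\prod_(i < n) lebesgue_measure (A i))%E.
Proof.
elim: n => [|n IH] in A *.
  by move=> _; rewrite big_ord0 /= diracE mem_set//; case.
move=> mA; rewrite big_ord_recl /= /lebesgue_cV_step /pushforward.
rewrite -(IH (fun i => A (lift ord0 i)))//.
pose B := [set v : 'cV[R]_n | forall i, A (lift ord0 i) (v i ord0)]; rewrite -/B.
have mB : measurable B.
  rewrite (_ : B = \bigcap_(i : 'I_n)
      ((fun v : 'cV[R]_n => v i ord0) @^-1` A (lift ord0 i))).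
    apply: fin_bigcap_measurable => // i _; rewrite -[X in measurable X]setTI.
    exact: (measurable_mx_coord i ord0).
  by apply/seteqP; split=> [v Bv i _|v Bv i]; [exact: Bv|exact: (Bv i Logic.I)].
rewrite -product_measure1E//; last exact: mA.
congr (product_measure1 _ _ _).
have cons0 (p : measurableTypeR R * 'cV[R]_n) : cV_cons p ord0 ord0 = p.1.
  by case: p => r v; have [] := cV_consK (r, v).
have consS (p : measurableTypeR R * 'cV[R]_n) i :
    cV_cons p (lift ord0 i) ord0 = p.2 i ord0.
  rewrite -(rshift1 i); exact: (@col_mxEd _ 1 n 1 (p.1 : R)%:M p.2 i ord0).
apply/seteqP; split=> [p pA|p [pA pB] i]; first split.
- by rewrite -cons0; exact: pA.
- by move=> i; rewrite -consS; exact: pA.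
- case: (unliftP ord0 i) => [j|] ->; first by rewrite consS; exact: pB.
  by rewrite cons0.
Qed.

(* The Minkowski sum of two convex Borel sets need not be Borel, and mu takes
   arbitrary values off the Borel sets; hence the outer measure mu_ext mu, which
   equals mu on Borel sets (measurable_mu_extE) and, when mu has a density, the
   completion of mu on convex sets. *)
Definition log_concave_measure (R : realType) (n : nat)
    (mu : probability 'cV[R]_n R) : Prop :=
  forall (A B : set 'cV[R]_n) (z : R),
    measurable A -> measurable B -> convex_set A -> convex_set B ->
    A !=set0 -> B !=set0 -> 0 <= z <= 1 ->
    (mu A `^ z * mu B `^ (1 - z) <=
     mu_ext mu [set a + b | a in ( *:%R z @` A) & b in ( *:%R (1 - z) @` B)]%R)%E.

(* lne 0 = -oo and 0 * -oo = 0, so that the endpoints z = 0, 1 are vacuous even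
   where f vanishes. *)
Definition log_concave_fun (R : realType) (V : lmodType R) (f : V -> R) : Prop :=
  (forall x, 0 <= f x) /\
  forall (x y : V) (z : R), 0 <= z <= 1 ->
    (z%:E * lne (f x)%:E + (1 - z)%:E * lne (f y)%:E <=
     lne (f (z *: x + (1 - z) *: y)%R)%:E)%E.

Definition has_density (R : realType) (n : nat)
    (mu : probability 'cV[R]_n R) : Prop :=
  exists f : 'cV[R]_n -> R,
    [/\ measurable_fun setT f, (forall x, 0 <= f x) &
        forall A, measurable A ->
          mu A = (\int[lebesgue_cV R n]_(x in A) (f x)%:E)%E].

Section random_vectors.
Context d (T : measurableType d) (R : realType) (P : probability T R).
Context (N p : nat).

Definition independent_RVs (w : 'I_N -> {RV P >-> 'cV[R]_p}) : Prop :=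
  forall (J : {set 'I_N}) (E : 'I_N -> set 'cV[R]_p),
    (forall i, measurable (E i)) ->
    P (\bigcap_(i in [set i | i \in J]) (w i @^-1` E i)) =
    (\prod_(i in J) P (w i @^-1` E i))%E.

Definition iid_with_law (w : 'I_N -> {RV P >-> 'cV[R]_p})
    (Pw : probability 'cV[R]_p R) : Prop :=
  independent_RVs w /\
  forall i E, measurable E -> distribution P (w i) E = Pw E.

End random_vectors.

(* The state process is x : nat -> T -> R^n; only x 0, ..., x N are
   constrained. *)
Definition dpv_trajectory (R : realType) (T : Type) (N n m p l : nat)
    (Par : set 'cV[R]_l) (A : Par -> 'M[R]_n) (B : Par -> 'M[R]_(n, m))
    (F : Par -> 'M[R]_(n, p)) (x0 : 'cV[R]_n) (lam : 'I_N -> Par)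
    (u : 'I_N -> 'cV[R]_m) (w : 'I_N -> T -> 'cV[R]_p)
    (x : nat -> T -> 'cV[R]_n) : Prop :=
  (forall o, x 0%N o = x0) /\
  forall (t : 'I_N) o,
    x t.+1 o = A (lam t) *m x t o + B (lam t) *m u t + F (lam t) *m w t o.

Definition obstacle (R : realType) (n : nat) (h : 'cV[R]_n -> R)
    (c : 'cV[R]_n) : set 'cV[R]_n :=
  [set z | 0 <= h (z - c)].

Section occupancy.
Context d (T : measurableType d) (R : realType) (P : probability T R).
Context (n : nat) (h : 'cV[R]_n -> R) (x : nat -> T -> 'cV[R]_n).

(* fine loses nothing: a probability is finite. *)
Definition occupancy (tau : nat) (y : 'cV[R]_n) : R :=
  fine (P (x tau @^-1` [set z | obstacle h z y])).

Definition pr_occupy_set (alpha : R) (tau : nat) : set 'cV[R]_n :=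
  [set y | alpha <= occupancy tau y].

End occupancy.

(* Main.v *)
(* Call a law log-concave if mu(A)^z mu(B)^(1-z) <= mu(C) whenever A, B are
   convex and C contains zA + (1-z)B. This class is stable under affine
   images of products: by Fubini the product measure of a convex set is the
   integral of a log-concave function, so one needs the Prekopa-Leindler
   inequality (int f)^z (int g)^(1-z) <= int h for log-concave f, g and a
   log-concave mu. Since int f dmu = int_R e^(-x) mu{f >= e^(-x)} dx and
   superlevel sets of f, g are convex, log-concavity of mu reduces this to
   functions on the line; there, after dividing by the suprema, a layer-cake
   formula, Brunn-Minkowski for intervals and the AM-GM inequality conclude.
   The state x_(t+1) is an affine image of the independent pair (x_t, w_t),
   so the law of every x_t is log-concave, and the sets
   K(y) = {c | y in O(c)} are convex and zK(y) + (1-z)K(y') is contained in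
   K(zy + (1-z)y'). *)
Require Import Defs.
From HB Require Import structures.
From mathcomp Require Import all_boot all_order all_algebra.
From mathcomp Require Import all_classical all_reals all_analysis.
From mathcomp Require Import measurable_realfun ring lra.

Set Implicit Arguments.
Unset Strict Implicit.
Unset Printing Implicit Defensive.

Import Order.TTheory GRing.Theory Num.Theory.
Import numFieldNormedType.Exports.

Local Open Scope classical_set_scope.
Local Open Scope ring_scope.

(** * Inequalities on the line *)

Lemma convex_setP (R : realType) (V : lmodType R) (A : set V) :
  convex_set A <-> forall x y (z : R), 0 <= z <= 1 -> A x -> A y ->
    A (z *: x + (1 - z) *: y).
Proof.
split=> [cA x y z /andP[z0 z1] Ax Ay|cA x y z].
  by have /set_mem := cA x y (Itv01 z0 z1) (mem_set Ax) (mem_set Ay).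
move=> /set_mem Ax /set_mem Ay; apply/mem_set; apply: cA => //.
by rewrite ge0 le1.
Qed.

(** A non-empty such set is bounded above, and each of its points lies at most [K] below its
    supremum, so an interval of length [K] ending there covers it. *)
Lemma lebesgue_measure_le_diam (R : realType) (I : set R) (K : R) :
  measurable I -> (forall x y, I x -> I y -> y - x <= K) -> 0 <= K ->
  (lebesgue_measure I <= K%:E)%E.
Proof.
move=> mI IK K0; have [->|/set0P[x0 Ix0]] := eqVneq I set0.
  by rewrite measure0 lee_fin.
have supI : has_sup I.
  by split; [exists x0|exists (x0 + K) => x Ix; rewrite -lerBlDl; exact: IK].
have IsK : I `<=` `[sup I - K, sup I].
  move=> x Ix; rewrite /= in_itv/= lerBlDr; apply/andP; split.
    by apply: ge_sup => [|y Iy]; [exists x0|rewrite -lerBlDl; exact: IK].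
  by apply: ub_le_sup => //; case: supI.
apply: (@le_trans _ _ (lebesgue_measure `[sup I - K, sup I]%classic)).
  by apply: le_measure => //; rewrite inE.
rewrite lebesgue_measure_itv /= EFinB.
by case: ifPn => _; rewrite lee_fin ?opprB ?subrKC//.
Qed.

(** By convexity, pairs [x], [x'] in [I] and [y], [y'] in [J] yield a whole segment inside [C],
    whose length is the weighted sum of the two differences. Bounding the differences in [I] first
    and those in [J] afterwards replaces them by the measures. *)
Lemma brunn_minkowski_itv (R : realType) (I J C : set R) (z : R) :
  0 < z < 1 -> I !=set0 -> J !=set0 ->
  convex_set (I : set R^o) -> convex_set (J : set R^o) ->
  measurable I -> measurable J -> measurable C ->
  (forall x y, I x -> J y -> C (z * x + (1 - z) * y)) ->
  (z%:E * lebesgue_measure I + (1 - z)%:E * lebesgue_measure J <=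
   lebesgue_measure C)%E.
Proof.
move=> /andP[z0 z1] [xI Ix] [yJ Jy] /convex_setP cI /convex_setP cJ.
move=> mI mJ mC IJC.
have z1' : 0 < 1 - z by rewrite subr_gt0.
case: (boolP (lebesgue_measure C \is a fin_num)) => [Cfin|]; last first.
  by rewrite ge0_fin_numE// -leNgt leye_eq => /eqP ->; rewrite leey.
pose L := fine (lebesgue_measure C).
have LE : lebesgue_measure C = L%:E by rewrite fineK.
have L0 : 0 <= L by rewrite fine_ge0.
have key x x' y y' : I x -> I x' -> J y -> J y' ->
    z * (x' - x) + (1 - z) * (y' - y) <= L.
  move=> Ix1 Ix2 Jy1 Jy2.
  pose p := z * x + (1 - z) * y; pose q := z * x' + (1 - z) * y'.
  have -> : z * (x' - x) + (1 - z) * (y' - y) = q - p by rewrite /p /q; ring.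
  have [pq|pq] := leP q p; first by rewrite (le_trans _ L0)// subr_le0.
  have pqC : `[p, q]%classic `<=` C.
    move=> r; rewrite /= in_itv/= => /andP[pr rq].
    (* The barycentric coordinate of [r] between [p] and [q]; the same weight is then used in [I]
       and in [J]. *)
    pose t := (q - r) / (q - p).
    have qp0 : q - p != 0 by rewrite gt_eqF// subr_gt0.
    have t01 : 0 <= t <= 1.
      rewrite /t divr_ge0 ?subr_ge0 ?(ltW pq)//=.
      by rewrite ler_pdivrMr ?subr_gt0// mul1r lerB.
    have -> : r = z * (t * x + (1 - t) * x') + (1 - z) * (t * y + (1 - t) * y').
      transitivity (t * p + (1 - t) * q); last by rewrite /p /q; ring.
      by rewrite /t; field.
    by apply: IJC; [exact: cI|exact: cJ].
  rewrite -lee_fin -LE.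
  apply: (@le_trans _ _ (lebesgue_measure `[p, q]%classic)); last first.
    by apply: le_measure => //; rewrite inE.
  by rewrite lebesgue_measure_itv /= lte_fin pq EFinB.
have lamI y y' : J y -> J y' ->
    (lebesgue_measure I <= ((L - (1 - z) * (y' - y)) / z)%:E)%E.
  move=> Jy1 Jy2; apply: lebesgue_measure_le_diam => [//|x x' Ix1 Ix2|].
    by rewrite ler_pdivlMr// lerBrDr mulrC; exact: key.
  rewrite divr_ge0 ?(ltW z0)// subr_ge0.
  by have := key _ _ _ _ Ix Ix Jy1 Jy2; rewrite subrr mulr0 add0r.
have Ifin : lebesgue_measure I \is a fin_num.
  by rewrite ge0_fin_numE // (le_lt_trans (lamI _ _ Jy Jy))// ltry.
pose K := fine (lebesgue_measure I).
have KE : lebesgue_measure I = K%:E by rewrite fineK.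
(* [lamI] holds for every pair in [J]; solved for [y' - y], it bounds all differences in [J] in
   terms of the measure [K] of [I]. *)
have lamJ : (lebesgue_measure J <= ((L - z * K) / (1 - z))%:E)%E.
  have aux y y' : J y -> J y' -> y' - y <= (L - z * K) / (1 - z).
    move=> Jy1 Jy2; rewrite ler_pdivlMr//; have := lamI _ _ Jy1 Jy2.
    by rewrite KE lee_fin ler_pdivlMr//; lra.
  apply: lebesgue_measure_le_diam => //.
  by have := aux _ _ Jy Jy; rewrite subrr.
have Jfin : lebesgue_measure J \is a fin_num.
  by rewrite ge0_fin_numE // (le_lt_trans lamJ)// ltry.
move: lamJ; rewrite -(fineK Jfin) KE LE -!EFinM -EFinD !lee_fin.
by rewrite ler_pdivlMr//; lra.
Qed.

(** Fubini-Tonelli for the region under the graph, cut off at height 1. For non-negative [f] the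
    right side integrates the minimum of [f] and 1, by [lebesgue_measure_cut]. *)
Lemma layer_cake01 d (T : measurableType d) (R : realType)
    (mu : {sigma_finite_measure set T -> \bar R}) (f : T -> R) :
  measurable_fun setT f ->
  (\int[lebesgue_measure]_(q in `]0%R, 1%R[) mu [set x | (q <= f x)%R] =
   \int[mu]_x lebesgue_measure (`]0%R, 1%R[ `&` [set q : R | (q <= f x)%R]))%E.
Proof.
move=> mf.
pose A := [set qx : measurableTypeR R * T |
  (qx.1 : R) \in `]0, 1[%R /\ qx.1 <= f qx.2].
have mA : measurable A.
  rewrite (_ : A = (fst @^-1` `]0, 1[) `&` [set qx | qx.1 <= f qx.2])//.
  apply: measurableI.
    by rewrite -[X in measurable X]setTI; apply: measurable_fst.
  rewrite -[X in measurable X]setTI.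
  apply: (measurable_fun_le measurableT measurable_fst).
  exact: (measurableT_comp mf measurable_snd).
pose lam : {sigma_finite_measure set (measurableTypeR R) -> \bar R} :=
  lebesgue_measure.
have := indic_fubini_tonelli lam mu mA.
rewrite indic_fubini_tonelli_FE// indic_fubini_tonelli_GE// => E.
rewrite integral_mkcond.
transitivity (\int[lebesgue_measure]_q (mu \o xsection A) q)%E.
  apply: eq_integral => q _; rewrite patchE /=.
  case: ifPn => [/set_mem q01|q01].
    congr (mu _); rewrite /xsection; apply/seteqP; split => x /=.
      by move=> qf; apply/mem_set; split.
    by move=> /set_mem[].
  rewrite (_ : xsection A q = set0) ?measure0//.
  apply/seteqP; split => x //; rewrite /xsection /= => /set_mem[/= q01' _].
  by move/negP: q01; apply; apply/mem_set.
rewrite E; apply: eq_integral => x _ /=; congr (lebesgue_measure _).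
apply/seteqP; split => q; rewrite /ysection /=.
  by move=> /set_mem.
by move=> ?; apply/mem_set.
Qed.

Lemma powR_mul_onem (R : realType) (q z : R) : 0 < q ->
  q `^ z * q `^ (1 - z) = q.
Proof.
by move=> q0; rewrite -powRD ?subrKC ?powRr1 ?(ltW q0)// (gt_eqF q0) implybT.
Qed.

(** Young's inequality for the conjugate exponents 1/z and 1/(1 - z); an infinite argument makes the
    right side infinite. *)
Lemma weighted_am_gm (R : realType) (z : R) (a b : \bar R) :
  0 < z < 1 -> (0 <= a)%E -> (0 <= b)%E ->
  (a `^ z * b `^ (1 - z) <= z%:E * a + (1 - z)%:E * b)%E.
Proof.
move=> /andP[z0 z1]; have z1' : 0 < 1 - z by rewrite subr_gt0.
case: a => [a||] //; case: b => [b||] //; rewrite ?lee_fin => a0 b0.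
- have := @conjugate_powR R (a `^ z) (b `^ (1 - z)) z^-1 (1 - z)^-1
     (powR_ge0 _ _) (powR_ge0 _ _).
  rewrite !invr_gt0 !invrK -!powRrM !mulfV ?gt_eqF// !powRr1//.
  by move=> /(_ z0 z1' (subrKC _ _)); rewrite mulrC [_ * b]mulrC [z * a]mulrC.
- by rewrite gt0_muley ?lte_fin// addey ?leey.
- by rewrite gt0_muley ?lte_fin// addye ?leey.
- by rewrite !gt0_muley ?lte_fin// addye ?leey.
Qed.

Lemma measurable_fun_superlevel d (T : measurableType d) (R : realType)
    (mu : {sigma_finite_measure set T -> \bar R}) (f : T -> R) :
  measurable_fun setT f ->
  measurable_fun setT (fun q : R => mu [set x | q <= f x]).
Proof.
move=> mf.
pose A := [set qx : measurableTypeR R * T | qx.1 <= f qx.2].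
have mA : measurable A.
  rewrite -[X in measurable X]setTI.
  apply: (measurable_fun_le measurableT measurable_fst).
  exact: (measurableT_comp mf measurable_snd).
rewrite (_ : (fun _ => _) = mu \o xsection A).
  exact: measurable_fun_xsection.
apply/funext => q /=; congr (mu _); apply/seteqP; split => x /=.
  by move=> qx; apply/mem_set.
by move=> /set_mem.
Qed.

Lemma lebesgue_measure_cut (R : realType) (c : R) : 0 <= c ->
  lebesgue_measure (`]0%R, 1%R[ `&` [set q : R | q <= c]) = (Num.min c 1)%:E.
Proof.
move=> c0; have [c1|c1] := ltP c 1.
  rewrite (_ : _ `&` _ = `]0%R, c]%classic).
    rewrite lebesgue_measure_itv /= lte_fin sube0.
    by case: ltP => // c0'; congr EFin; apply/eqP; rewrite eq_le c0 c0'.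
  apply/seteqP; split => q /=; rewrite !in_itv/=.
    by move=> [/andP[-> _] ->].
  by move=> /andP[-> qc]; rewrite qc (le_lt_trans qc).
rewrite (_ : _ `&` _ = `]0%R, 1%R[%classic).
  by rewrite lebesgue_measure_itv /= lte_fin ltr01 sube0.
apply/seteqP; split => q /=; rewrite !in_itv/=; first by move=> [/andP[-> ->]].
by move=> /andP[-> q1]; rewrite q1 (le_trans (ltW q1)).
Qed.

(* The suprema being equal, the superlevel sets of phi and psi at a common
   height are simultaneously non-empty, so Brunn-Minkowski applies to them. *)
Lemma prekopa_leindler_sup1 (R : realType) (phi psi chi : R -> R) (z : R) :
  0 < z < 1 ->
  measurable_fun setT phi -> measurable_fun setT psi ->
  measurable_fun setT chi ->
  (forall x, 0 <= phi x <= 1) -> (forall x, 0 <= psi x <= 1) ->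
  (forall x, 0 <= chi x) ->
  (forall q, q < 1 -> exists x, q <= phi x) ->
  (forall q, q < 1 -> exists x, q <= psi x) ->
  (forall q, 0 < q -> convex_set ([set x | q <= phi x] : set R^o)) ->
  (forall q, 0 < q -> convex_set ([set x | q <= psi x] : set R^o)) ->
  (forall q x y, 0 < q -> q <= phi x -> q <= psi y ->
     q <= chi (z * x + (1 - z) * y)) ->
  (z%:E * \int[lebesgue_measure]_x (phi x)%:E +
   (1 - z)%:E * \int[lebesgue_measure]_x (psi x)%:E <=
   \int[lebesgue_measure]_x (chi x)%:E)%E.
Proof.
move=> z01 mphi mpsi mchi phi01 psi01 chi0 phi1 psi1 cphi cpsi H.
have /andP[z0 z1] := z01; have z1' : 0 < 1 - z by rewrite subr_gt0.
pose lam : {sigma_finite_measure set (measurableTypeR R) -> \bar R} :=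
  lebesgue_measure.
have lcake (g : R -> R) : measurable_fun setT g -> (forall x, 0 <= g x <= 1) ->
    (\int[lam]_x (g x)%:E =
     \int[lam]_(q in `]0%R, 1%R[) lam [set x | (q <= g x)%R])%E.
  move=> mg g01; have := layer_cake01 lam mg; rewrite -/lam => ->.
  apply: eq_integral => x _; have /andP[g0 g1] := g01 x.
  by rewrite [RHS]lebesgue_measure_cut// (min_idPl g1).
have lmeas (g : R -> R) (D : set (measurableTypeR R)) : measurable_fun setT g ->
    measurable_fun D (fun q : R => lam [set x | q <= g x]).
  by move=> mg; apply: measurable_funTS; exact: measurable_fun_superlevel.
have msup (g : R -> R) q : measurable_fun setT g ->
    measurable [set x | q <= g x].
  move=> mg; rewrite -[X in measurable X]setTI.
  exact: (measurable_fun_le measurableT).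
rewrite -/lam (lcake phi)// (lcake psi)//.
rewrite -ge0_integralZl_EFin ?(ltW z0)//; last exact: lmeas.
rewrite -ge0_integralZl_EFin ?(ltW z1')//; last exact: lmeas.
rewrite -ge0_integralD//; last 4 first.
- by move=> q _; rewrite mule_ge0// lee_fin ltW.
- by apply: measurable_funeM; exact: lmeas.
- by move=> q _; rewrite mule_ge0// lee_fin ltW.
- by apply: measurable_funeM; exact: lmeas.
apply: (@le_trans _ _
    (\int[lam]_(q in `]0%R, 1%R[) lam [set x | (q <= chi x)%R])%E).
  apply: ge0_le_integral => //.
  - by move=> q _; rewrite adde_ge0// mule_ge0// lee_fin ltW.
  - by apply: emeasurable_funD; apply: measurable_funeM; exact: lmeas.
  - exact: lmeas.
  - move=> q; rewrite /= in_itv/= => /andP[q0 q1].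
    apply: brunn_minkowski_itv => //; [exact: phi1|exact: psi1|exact: cphi|
      exact: cpsi|exact: msup|exact: msup|exact: msup|].
    by move=> x y; exact: H.
(* For [phi] and [psi], bounded by 1, the cut at height 1 loses nothing. It may lose mass of [chi],
   but here an inequality in that direction suffices. *)
have := layer_cake01 lam mchi; rewrite -/lam => ->.
apply: ge0_le_integral => //.
- rewrite (_ : (fun _ => _) = (fun x => (Num.min (chi x) 1)%:E)).
    by apply/measurable_EFinP; exact: measurable_minr.
  by apply/funext => x; exact: lebesgue_measure_cut.
- exact/measurable_EFinP.
- move=> x _; rewrite [leLHS]lebesgue_measure_cut//.
  by rewrite lee_fin ge_min lexx.
Qed.

(** [M] is the supremum, which need not be attained; hence points of height at least [q] are
    provided only for [q < 1]. Level [q] of the quotient is level [q * M] of [phi], so convexity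
    carries over. *)
Lemma normalize_sup (R : realType) (phi : R -> R) :
  measurable_fun setT phi -> (forall x, 0 <= phi x <= 1) ->
  (forall q, 0 < q -> convex_set ([set x | q <= phi x] : set R^o)) ->
  (exists x, 0 < phi x) ->
  exists M, [/\ 0 < M, measurable_fun setT (fun x => phi x / M),
    (forall x, 0 <= phi x / M <= 1),
    (forall q, q < 1 -> exists x, q <= phi x / M) &
    (forall q, 0 < q -> convex_set ([set x | q <= phi x / M] : set R^o))].
Proof.
move=> mphi phi01 cphi [x0 phix0].
have hs : has_sup (range phi).
  split; first by exists (phi x0), x0.
  by exists 1 => _ [x _ <-]; have /andP[] := phi01 x.
have ubM x : phi x <= sup (range phi) by apply: ub_le_sup; [case: hs|exists x].
have M0 : 0 < sup (range phi) by apply: lt_le_trans phix0 _.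
exists (sup (range phi)); split=> //.
- by apply: measurable_funM.
- move=> x; have /andP[p0 _] := phi01 x.
  by rewrite divr_ge0 ?(ltW M0)//= ler_pdivrMr// mul1r.
- move=> q q1.
  have [_ [x _ <-] qx] : exists2 y, range phi y & q * sup (range phi) < y.
    by apply: sup_gt; [case: hs|rewrite gtr_pMl].
  by exists x; rewrite ler_pdivlMr// ltW.
- move=> q q0.
  rewrite (_ : [set _ | _] = [set x | q * sup (range phi) <= phi x]).
    by apply: cphi; rewrite mulr_gt0.
  by apply/seteqP; split=> x /=; rewrite ler_pdivlMr.
Qed.

(** If [phi] or [psi] vanishes identically, the left side is zero. Otherwise both are rescaled to
    supremum 1, and [chi] is divided by the geometric mean [K] of the two factors, which preserves
    the mixing hypothesis and cancels from the claim. AM-GM then reduces the product to the additive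
    inequality. *)
Lemma prekopa_leindler_itv (R : realType) (phi psi chi : R -> R) (z : R) :
  0 < z < 1 ->
  measurable_fun setT phi -> measurable_fun setT psi ->
  measurable_fun setT chi ->
  (forall x, 0 <= phi x <= 1) -> (forall x, 0 <= psi x <= 1) ->
  (forall x, 0 <= chi x) ->
  (forall q, 0 < q -> convex_set ([set x | q <= phi x] : set R^o)) ->
  (forall q, 0 < q -> convex_set ([set x | q <= psi x] : set R^o)) ->
  (forall x y, phi x `^ z * psi y `^ (1 - z) <= chi (z * x + (1 - z) * y)) ->
  ((\int[lebesgue_measure]_x (phi x)%:E) `^ z *
   (\int[lebesgue_measure]_x (psi x)%:E) `^ (1 - z) <=
   \int[lebesgue_measure]_x (chi x)%:E)%E.
Proof.
move=> z01 mphi mpsi mchi phi01 psi01 chi0 cphi cpsi H.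
have /andP[z0 z1] := z01; have z1' : 0 < 1 - z by rewrite subr_gt0.
have [phi0|] := pselect (forall x, phi x = 0).
  under eq_integral do rewrite phi0.
  rewrite integral0 poweR0r ?gt_eqF// mul0e integral_ge0// => x _.
  by rewrite lee_fin.
have [psi0 _|] := pselect (forall x, psi x = 0).
  under [X in (_ * X `^ _)%E]eq_integral do rewrite psi0.
  rewrite integral0 (@poweR0r _ (1 - z)) ?gt_eqF// mule0 integral_ge0// => x _.
  by rewrite lee_fin.
move=> /existsNP[y0 /eqP psiy0] /existsNP[x0 /eqP phix0].
have [|M [M0 mphiM phiM01 phiM1 cphiM]] := normalize_sup mphi phi01 cphi.
  by exists x0; rewrite lt_neqAle eq_sym phix0; have /andP[] := phi01 x0.
have [|N [N0 mpsiN psiN01 psiN1 cpsiN]] := normalize_sup mpsi psi01 cpsi.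
  by exists y0; rewrite lt_neqAle eq_sym psiy0; have /andP[] := psi01 y0.
pose K := M `^ z * N `^ (1 - z).
have K0 : 0 < K by rewrite mulr_gt0// powR_gt0.
have ints (g : R -> R) (c : R) : 0 < c -> measurable_fun setT g ->
    (forall x, 0 <= g x) ->
    (\int[lebesgue_measure]_x (g x)%:E =
     c%:E * \int[lebesgue_measure]_x (g x / c)%:E)%E.
  move=> c0 mg g0; rewrite -ge0_integralZl_EFin ?(ltW c0)//.
  - by apply: eq_integral => x _; rewrite -EFinM mulrCA mulfV ?mulr1// gt_eqF.
  - by move=> x _; rewrite lee_fin divr_ge0// ltW.
  - by apply/measurable_EFinP; exact: measurable_funM.
have phi0 x : 0 <= phi x by have /andP[] := phi01 x.
have psi0 x : 0 <= psi x by have /andP[] := psi01 x.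
rewrite (ints phi M)// (ints psi N)// (ints chi K)//.
have igt0 (g : R -> R) : (forall x, 0 <= g x) ->
    (0 <= \int[lebesgue_measure]_x (g x)%:E)%E.
  by move=> g0; apply: integral_ge0 => x _; rewrite lee_fin.
have i1 : (0 <= \int[lebesgue_measure]_x (phi x / M)%:E)%E.
  by apply: igt0 => x; rewrite divr_ge0// ltW.
have i2 : (0 <= \int[lebesgue_measure]_x (psi x / N)%:E)%E.
  by apply: igt0 => x; rewrite divr_ge0// ltW.
rewrite !poweRM ?lee_fin ?(ltW M0) ?(ltW N0)//.
rewrite muleACA !poweR_EFin -EFinM -/K lee_pmul2l//.
apply: (le_trans (weighted_am_gm z01 i1 i2)).
apply: prekopa_leindler_sup1 => //.
- exact: measurable_funM.
- by move=> x; rewrite divr_ge0// ltW.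
move=> q x y q0 qx qy.
rewrite ler_pdivlMr//; apply: le_trans (H x y).
rewrite -[q](powR_mul_onem z)// /K mulrACA.
rewrite -!powRM ?(ltW q0) ?(ltW M0) ?(ltW N0)//.
by apply: ler_pM; rewrite ?powR_ge0//; apply: ge0_ler_powR;
  rewrite ?nnegrE ?(ltW z0) ?(ltW z1') ?mulr_ge0 ?(ltW q0) ?(ltW M0)
    ?(ltW N0)// -ler_pdivlMr.
Qed.

(** The change of variables q = exp(-x) in the integral of 1 over ]0, c]. The domain is the
    half-line from [- ln c], and is empty when c = 0. *)
Lemma integral_expRN_superlevel (R : realType) (c : R) : 0 <= c ->
  (\int[lebesgue_measure]_(x in [set x | (expR (- x) <= c)%R]) (expR (- x))%:E =
   c%:E)%E.
Proof.
rewrite le_eqVlt => /predU1P[<-|c0].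
  rewrite (_ : [set _ | _] = set0) ?integral_set0//.
  by apply/seteqP; split => // x /=; rewrite leNgt expR_gt0.
rewrite (_ : [set _ | _] = `[- ln c, +oo[%classic); last first.
  apply/funext => x; apply/propext; rewrite /= in_itv/= andbT lerNl.
  by rewrite -[X in _ <-> is_true X]ler_expR lnK.
have dN (x : R) : is_derive x 1 (fun x => - expR (- x)) (expR (- x)).
  by apply: is_derive_eq; rewrite mulrN1 opprK.
rewrite (@ge0_continuous_FTC2y R (fun x => expR (- x))
  (fun x => - expR (- x)) (- ln c) 0)//.
- by rewrite sub0e -EFinN opprK opprK lnK.
- apply: continuous_subspaceT => x.
  by apply: continuous_comp; [exact: opp_continuous|exact: continuous_expR].
- by rewrite -oppr0; apply: cvgN; exact: cvgr_expR.
- apply: cvg_at_right_filter; apply: cvgN.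
  by apply: continuous_comp; [exact: opp_continuous|exact: continuous_expR].
- by move=> x _; rewrite derive1E derive_val.
Qed.

(** * Log-concave measures *)

(** Layer cake with heights written as exp(-x): geometric means of heights become arithmetic means
    of [x], as the inequality on the line requires. *)
Lemma layer_cake_expR d (T : measurableType d) (R : realType)
    (mu : {sigma_finite_measure set T -> \bar R}) (f : T -> R) :
  measurable_fun setT f -> (forall w, 0 <= f w) ->
  (\int[lebesgue_measure]_x
     ((expR (- x))%:E * mu [set w | (expR (- x) <= f w)%R]) =
   \int[mu]_w (f w)%:E)%E.
Proof.
move=> mf f0.
pose lam : {sigma_finite_measure set (measurableTypeR R) -> \bar R} :=
  lebesgue_measure.
pose F (xw : measurableTypeR R * T) : \bar R :=
  (if expR (- xw.1) <= f xw.2 then expR (- xw.1) else 0)%:E.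
have me : measurable_fun setT (fun xw : measurableTypeR R * T => expR (- xw.1)).
  apply: measurableT_comp => //; apply: measurableT_comp => //.
have mF : measurable_fun setT F.
  apply/measurable_EFinP; apply: measurable_fun_ifT => //.
  apply: measurable_fun_ler => //.
  exact: (measurableT_comp mf measurable_snd).
have F0 xw : (0 <= F xw)%E by rewrite /F; case: ifPn; rewrite lee_fin ?expR_ge0.
have := fubini_tonelli (m1 := lam) (m2 := mu) F mF F0.
have restr d' (S : measurableType d') (nu : {measure set S -> \bar R})
    (b : pred S) (g : S -> R) :
    (\int[nu]_s (if b s then g s else 0)%:E =
     \int[nu]_(s in [set s | b s]) (g s)%:E)%E.
  rewrite [RHS]integral_mkcond; apply: eq_integral => s _; rewrite patchE.
  by case: (boolP (b s)) => bs; [rewrite mem_set|rewrite memNset//; exact/negP].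
have -> : (\int[lam]_x \int[mu]_w F (x, w) = \int[lebesgue_measure]_x
     ((expR (- x))%:E * mu [set w | (expR (- x) <= f w)%R]))%E.
  apply: eq_integral => x _; rewrite /F /= restr integral_cst//.
  rewrite -[X in measurable X]setTI.
  exact: (measurable_fun_le measurableT).
move=> ->; apply: eq_integral => w _.
by rewrite /F /= restr integral_expRN_superlevel.
Qed.

(** With [f], [g], [h] equal and 0 < z < 1, this is log-concavity in multiplicative form: a zero
    value makes the left side zero, matching log 0 = -oo. *)
Definition log_mix (R : realType) (V : lmodType R) (z : R) (f g h : V -> R) :=
  forall x y, f x `^ z * g y `^ (1 - z) <= h (z *: x + (1 - z) *: y).

(** A measurable [C] containing the Minkowski combination stands in for it, so its own measurability
    never arises. Strict bounds on [z] avoid 0^0 = 1, which would make the condition fail for empty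
    [A] or [B]. *)
Definition log_concave_on_convex (R : realType) (n : nat)
    (mu : set 'cV[R]_n -> \bar R) :=
  forall (A B C : set 'cV[R]_n) (z : R), 0 < z < 1 ->
    measurable A -> measurable B -> measurable C ->
    convex_set A -> convex_set B ->
    (forall a b, A a -> B b -> C (z *: a + (1 - z) *: b)) ->
    (mu A `^ z * mu B `^ (1 - z) <= mu C)%E.

Lemma log_mix_superlevel (R : realType) (V : lmodType R) (z p q : R)
    (f g h : V -> R) x y :
  log_mix z f g h -> 0 < z < 1 -> 0 < p -> 0 < q ->
  p <= f x -> q <= g y ->
  p `^ z * q `^ (1 - z) <= h (z *: x + (1 - z) *: y).
Proof.
move=> H /andP[z0 z1] p0 q0 px qy; apply: le_trans (H x y).
have fx0 := lt_le_trans p0 px; have gy0 := lt_le_trans q0 qy.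
by apply: ler_pM; rewrite ?powR_ge0//; apply: ge0_ler_powR;
  rewrite ?nnegrE ?subr_ge0 ?(ltW z0) ?(ltW z1) ?(ltW p0) ?(ltW q0)
    ?(ltW fx0) ?(ltW gy0).
Qed.

(** The geometric mean of [q] with itself is [q]. The endpoints of [z] are treated apart, since
    mixing is assumed only strictly between them. *)
Lemma superlevel_convex (R : realType) (V : lmodType R) (f : V -> R) (q : R) :
  (forall z, 0 < z < 1 -> log_mix z f f f) -> 0 < q ->
  convex_set [set x | q <= f x].
Proof.
move=> H q0; apply/convex_setP => x y z /andP[]; rewrite le_eqVlt.
move=> /predU1P[<- _ _|z0]; first by rewrite scale0r add0r subr0 scale1r.
rewrite le_eqVlt => /predU1P[-> fx _|z1 fx fy].
  by rewrite subrr scale0r addr0 scale1r.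
have z01 : 0 < z < 1 by rewrite z0.
rewrite /= -[q](powR_mul_onem z)//.
exact: (log_mix_superlevel (H z z01)).
Qed.

Section prekopa_leindler.
Context (R : realType) (p : nat) (mu : probability 'cV[R]_p R).
Hypothesis mulc : log_concave_on_convex mu.

(** The integrand of [layer_cake_expR], made real-valued; [mu] being finite, [fine] loses nothing on
    measurable sets. *)
Let level (f : 'cV[R]_p -> R) (x : R) :=
  expR (- x) * fine (mu [set w | expR (- x) <= f w]).

Let mu_fin A : measurable A -> (fine (mu A))%:E = mu A.
Proof. by move=> mA; rewrite fineK// fin_num_measure. Qed.

Let mlev (f : 'cV[R]_p -> R) q : measurable_fun setT f ->
  measurable [set w | q <= f w].
Proof.
move=> mf; rewrite -[X in measurable X]setTI.
exact: (measurable_fun_le measurableT).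
Qed.

Let measurable_level (f : 'cV[R]_p -> R) : measurable_fun setT f ->
  measurable_fun setT (level f).
Proof.
move=> mf; apply: measurable_funM.
  by apply: measurableT_comp => //; exact: oppr_measurable.
apply: measurableT_comp => //.
apply: (measurableT_comp (measurable_fun_superlevel mu mf)).
by apply: measurableT_comp => //; exact: oppr_measurable.
Qed.

Let level01 (f : 'cV[R]_p -> R) :
  measurable_fun setT f -> (forall w, 0 <= f w <= 1) ->
  forall x, 0 <= level f x <= 1.
Proof.
move=> mf f01 x; rewrite mulr_ge0 ?expR_ge0 ?fine_ge0//=.
have [e1|e1] := leP (expR (- x)) 1.
  rewrite mulr_ile1 ?expR_ge0 ?fine_ge0//.
  by rewrite -lee_fin mu_fin ?probability_le1//; exact: mlev.
(* For a height exp(-x) above 1 the superlevel set is empty because [f] is at most 1; this keeps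
   [level f] bounded despite the exponential factor. *)
rewrite /level (_ : [set w | _] = set0) ?measure0 ?mulr0//.
apply/seteqP; split=> // w /=; have /andP[_ f1] := f01 w.
by rewrite leNgt (le_lt_trans f1 e1).
Qed.

Let integral_level (f : 'cV[R]_p -> R) :
  measurable_fun setT f -> (forall w, 0 <= f w <= 1) ->
  (\int[lebesgue_measure]_x (level f x)%:E = \int[mu]_w (f w)%:E)%E.
Proof.
move=> mf f01; rewrite -[RHS]layer_cake_expR//; last first.
  by move=> w; have /andP[] := f01 w.
by apply: eq_integral => x _; rewrite /level EFinM mu_fin//; exact: mlev.
Qed.

(** The exponential factors combine exactly. Superlevel sets of [f] and [g] at heights exp(-x) and
    exp(-y) combine into that of [h] at the geometric mean of the heights, so [mulc] applies to
    them. *)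
Let log_mix_level (z : R) (f g h : 'cV[R]_p -> R) : 0 < z < 1 ->
  measurable_fun setT f -> measurable_fun setT g -> measurable_fun setT h ->
  (forall z, 0 < z < 1 -> log_mix z f f f) ->
  (forall z, 0 < z < 1 -> log_mix z g g g) ->
  log_mix z f g h ->
  log_mix z (level f : R^o -> R) (level g) (level h).
Proof.
move=> z01 mf mg mh cf cg H x y; have /andP[z0 z1] := z01.
rewrite /level !powRM ?expR_ge0 ?fine_ge0//.
rewrite mulrACA -!expRM -expRD.
have -> : - x * z + - y * (1 - z) = - (z *: (x : R^o) + (1 - z) *: (y : R^o)).
  by rewrite /GRing.scale /=; ring.
rewrite ler_pM2l ?expR_gt0// -lee_fin EFinM -!poweR_EFin.
rewrite !mu_fin; [|exact: mlev..].
apply: mulc => //; [exact: mlev|exact: mlev|exact: mlev|..].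
- by apply: superlevel_convex => //; exact: expR_gt0.
- by apply: superlevel_convex => //; exact: expR_gt0.
move=> a b fa gb /=.
have := log_mix_superlevel H z01 (expR_gt0 _) (expR_gt0 _) fa gb.
rewrite -!expRM -expRD; apply: le_trans.
rewrite ler_expR le_eqVlt; apply/orP; left; apply/eqP.
by rewrite /GRing.scale /=; ring.
Qed.

(* The measure mu enters only through the measures of the convex
   superlevel sets, which reduces the claim to one dimension. *)
Lemma prekopa_leindler (f g h : 'cV[R]_p -> R) (z : R) : 0 < z < 1 ->
  measurable_fun setT f -> measurable_fun setT g -> measurable_fun setT h ->
  (forall w, 0 <= f w <= 1) -> (forall w, 0 <= g w <= 1) ->
  (forall w, 0 <= h w <= 1) ->
  (forall z, 0 < z < 1 -> log_mix z f f f) ->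
  (forall z, 0 < z < 1 -> log_mix z g g g) ->
  log_mix z f g h ->
  ((\int[mu]_w (f w)%:E) `^ z * (\int[mu]_w (g w)%:E) `^ (1 - z) <=
   \int[mu]_w (h w)%:E)%E.
Proof.
move=> z01 mf mg mh f01 g01 h01 cf cg H.
rewrite -!integral_level//; apply: prekopa_leindler_itv => //.
- exact: measurable_level.
- exact: measurable_level.
- exact: measurable_level.
- exact: level01.
- exact: level01.
- by move=> x; have /andP[] := level01 mh h01 x.
- move=> q; apply: superlevel_convex => t t01.
  exact: log_mix_level (cf t t01).
- move=> q; apply: superlevel_convex => t t01.
  exact: log_mix_level (cg t t01).
- exact: (log_mix_level z01 mf mg mh cf cg H).
Qed.

End prekopa_leindler.

(** [C] contains the Minkowski combination, so its measure dominates the outer measure of the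
    latter. Empty [A] or [B] gives a zero left side, as [z] is interior. *)
Lemma log_concave_measureW (R : realType) (n : nat)
    (mu : probability 'cV[R]_n R) :
  log_concave_measure mu -> log_concave_on_convex mu.
Proof.
move=> H A B C z z01 mA mB mC cA cB ABC; have /andP[z0 z1] := z01.
have z1' : 0 < 1 - z by rewrite subr_gt0.
have [->|/set0P A0] := eqVneq A set0.
  by rewrite measure0 poweR0r ?gt_eqF// mul0e.
have [->|/set0P B0] := eqVneq B set0.
  by rewrite measure0 (@poweR0r _ (1 - z)) ?gt_eqF// mule0.
have z01' : 0 <= z <= 1 by rewrite !ltW.
apply: (le_trans (H A B z mA mB cA cB A0 B0 z01')).
rewrite -(measurable_mu_extE mu mC); apply: le_mu_ext.
by move=> _ [_ [a Aa <-]] [_ [b Bb <-]] <-; exact: ABC.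
Qed.

Lemma measurable_affine_cV (R : realType) (n p k : nat) (L : 'M[R]_(k, n))
    (M : 'M[R]_(k, p)) (b : 'cV[R]_k) :
  measurable_fun [set: 'cV[R]_n * 'cV[R]_p]
    (fun vw : 'cV[R]_n * 'cV[R]_p => L *m vw.1 + b + M *m vw.2).
Proof.
have mmul q (Q : 'M[R]_(k, q)) (g : 'cV[R]_n * 'cV[R]_p -> 'cV[R]_q) i :
    measurable_fun setT g -> measurable_fun setT (fun vw => (Q *m g vw) i ord0).
  move=> mg; under eq_fun do rewrite mxE.
  apply: measurable_sum => j; apply: measurable_funM => //.
  exact: (measurableT_comp (measurable_mx_coord j ord0) mg).
apply/measurable_fun_mxP => i j; rewrite ord1.
under eq_fun do rewrite mxE [X in X + _]mxE.
apply: measurable_funD; last exact: mmul.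
by apply: measurable_funD => //; exact: mmul.
Qed.

(* Fubini writes the mass of A as the integral of the log-concave function
   v |-> mu (section of A at v), to which Prekopa-Leindler for nu applies. *)
Lemma log_concave_on_convex_affine (R : realType) (n p k : nat)
    (nu : probability 'cV[R]_n R) (mu : probability 'cV[R]_p R)
    (L : 'M[R]_(k, n)) (M : 'M[R]_(k, p)) (b : 'cV[R]_k) :
  log_concave_on_convex nu -> log_concave_on_convex mu ->
  log_concave_on_convex (fun A : set 'cV[R]_k =>
    (nu \x mu)%E [set vw | A (L *m vw.1 + b + M *m vw.2)]).
Proof.
move=> nuc muc A B C z z01 mA mB mC cA cB ABC.
pose S (D : set 'cV[R]_k) := [set vw | D (L *m vw.1 + b + M *m vw.2)].
pose f (D : set 'cV[R]_k) v := fine (mu (xsection (S D) v)).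
have mS D : measurable D -> measurable (S D).
  by move=> mD; rewrite -[X in measurable X]setTI; exact: measurable_affine_cV.
have mx D v : measurable D -> measurable (xsection (S D) v).
  by move=> mD; apply: measurable_xsection; exact: mS.
have xE D v w : xsection (S D) v w <-> D (L *m v + b + M *m w).
  by rewrite /xsection /=; split=> [/set_mem//|Dw]; exact: mem_set.
have mixE v v' w w' (t : R) :
    L *m (t *: v + (1 - t) *: v') + b + M *m (t *: w + (1 - t) *: w') =
    t *: (L *m v + b + M *m w) + (1 - t) *: (L *m v' + b + M *m w').
  rewrite !mulmxDr -!scalemxAr !scalerDr.
  have {1}-> : b = t *: b + (1 - t) *: b by rewrite -scalerDl subrKC scale1r.
  by rewrite !addrA -!(addrAC _ (t *: b)) -!(addrAC _ (t *: (M *m w))) //.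
have cx D v : convex_set D -> convex_set (xsection (S D) v).
  move=> /convex_setP cD; apply/convex_setP => w w' t t01 /xE Dw /xE Dw'.
  apply/xE; have -> : v = t *: v + (1 - t) *: v.
    by rewrite -scalerDl subrKC scale1r.
  by rewrite mixE; exact: cD.
have mu_fin D v : measurable D -> (f D v)%:E = mu (xsection (S D) v).
  by move=> mD; rewrite fineK// fin_num_measure//; exact: mx.
have f01 D v : measurable D -> 0 <= f D v <= 1.
  move=> mD; rewrite fine_ge0//= -lee_fin mu_fin// probability_le1//.
  exact: mx.
have mf D : measurable D -> measurable_fun setT (f D).
  move=> mD; apply: measurableT_comp => //.
  exact: (measurable_fun_xsection mu (mS D mD)).
have intE D : measurable D -> (nu \x mu)%E (S D) = (\int[nu]_v (f D v)%:E)%E.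
  by move=> mD; apply: eq_integral => v _; rewrite mu_fin.
(* The combination of the sections at [v] and [v'] lies in the section of [D''] at the combined
   point, because the affine map preserves convex combinations; log-concavity of [mu] does the
   rest. *)
have mix (D D' D'' : set 'cV[R]_k) (t : R) : 0 < t < 1 ->
    measurable D -> measurable D' -> measurable D'' ->
    convex_set D -> convex_set D' ->
    (forall d d', D d -> D' d' -> D'' (t *: d + (1 - t) *: d')) ->
    log_mix t (f D) (f D') (f D'').
  move=> t01 mD mD' mD'' cD cD' DD v v'; rewrite -lee_fin EFinM -!poweR_EFin.
  rewrite !mu_fin//; apply: muc; rewrite //; [exact: mx|exact: mx|exact: mx|
    exact: cx|exact: cx|].
  by move=> w w' /xE Dw /xE Dw'; apply/xE; rewrite mixE; exact: DD.
have mix1 (D : set 'cV[R]_k) (t : R) :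
    0 < t < 1 -> measurable D -> convex_set D ->
    log_mix t (f D) (f D) (f D).
  move=> t01 mD cD; apply: mix => // d d' Dd Dd'.
  by move/convex_setP: cD; apply=> //; have /andP[? ?] := t01; rewrite !ltW.
rewrite -/(S A) -/(S B) -/(S C) !intE//; apply: prekopa_leindler => //.
- exact: mf.
- exact: mf.
- exact: mf.
- by move=> v; exact: f01.
- by move=> v; exact: f01.
- by move=> v; exact: f01.
- by move=> t t01; exact: mix1.
- by move=> t t01; exact: mix1.
- exact: mix.
Qed.

(** * The law of the state *)

(** When P(H) > 0, the law of the pair conditioned on [H] agrees with the product law on rectangles,
    hence everywhere by uniqueness of the product measure. Keeping [H] as a parameter lets
    independence of later disturbances pass from rectangles to all measurable [G]. *)
Lemma independent_pair_law d dU dV (T : measurableType d)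
    (U : measurableType dU) (V : measurableType dV) (R : realType)
    (P : probability T R) (X : {mfun T >-> U}) (Y : {mfun T >-> V})
    (H : set T) :
  measurable H ->
  (forall D D', measurable D -> measurable D' ->
    P (X @^-1` D `&` Y @^-1` D' `&` H) =
    (P (X @^-1` D) * P (Y @^-1` D') * P H)%E) ->
  forall G, measurable G ->
    P ([set t | G (X t, Y t)] `&` H) =
    ((distribution P X \x distribution P Y) G * P H)%E.
Proof.
move=> mH XYH G mG.
have mXY : measurable_fun setT (fun t => (X t, Y t)).
  by apply/measurable_fun_pairP; split; exact: measurable_funPT.
have mE (E : set (U * V)) : measurable E -> measurable [set t | E (X t, Y t)].
  by move=> ?; rewrite -[X in measurable X]setTI; exact: (mXY measurableT).
have Hfin : P H \is a fin_num by rewrite fin_num_measure.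
have [H0|H0] := eqVneq (P H) 0%E.
  rewrite H0 mule0; apply/eqP; rewrite eq_le measure_ge0 andbT -H0.
  by apply: le_measure; rewrite ?inE//; apply: measurableI => //; exact: mE.
have c0 : 0 < fine (P H) by rewrite fine_gt0// lt0e H0 measure_ge0 ltey_eq Hfin.
have ci0 : 0 <= (fine (P H))^-1 by rewrite invr_ge0 ltW.
(* m' is a function of the measurability proof that the measure instance of
   pushforward takes. *)
pose m' : {measure set (U * V) -> \bar R} :=
  mscale (NngNum ci0) (pushforward (mrestr P mH) (fun t => (X t, Y t))).
have E (D : set U) (D' : set V) : measurable D -> measurable D' ->
    m' mXY (D `*` D') = (distribution P X D * distribution P Y D')%E.
  move=> mD mD'; transitivity ((fine (P H))^-1%:E *
      P (X @^-1` D `&` Y @^-1` D' `&` H))%E; first by [].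
  rewrite XYH// -[P H in X in (_ * X)%E]fineK// muleC -muleA -EFinM.
  by rewrite mulfV ?gt_eqF// mule1.
rewrite (product_measure_unique E mG).
transitivity ((fine (P H))^-1%:E *
  P ([set t | G (X t, Y t)] `&` H) * P H)%E; last by [].
by rewrite -[P H in X in (_ * X)%E]fineK// muleAC -EFinM mulVf ?gt_eqF// mul1e.
Qed.

(** Covers the deterministic initial state. The left side is non-zero only if [a] lies in both [A]
    and [B], and then [a], as a combination of itself, lies in [C]. *)
Lemma log_concave_on_convex_dirac (R : realType) (n : nat) (a : 'cV[R]_n)
    (mu : set 'cV[R]_n -> \bar R) :
  (forall A, measurable A -> mu A = \d_a A) -> log_concave_on_convex mu.
Proof.
move=> muE A B C z /andP[z0 z1] mA mB mC _ _ ABC.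
have z1' : 0 < 1 - z by rewrite subr_gt0.
rewrite !muE// !diracE; have [/set_mem Aa|_] := boolP (a \in A); last first.
  by rewrite poweR0r ?gt_eqF// mul0e lee_fin.
have [/set_mem Ba|_] := boolP (a \in B); last first.
  by rewrite (@poweR0r _ (1 - z)) ?gt_eqF// mule0 lee_fin.
rewrite mem_set ?poweR1r ?mule1//.
have <- : z *: a + (1 - z) *: a = a by rewrite -scalerDl subrKC scale1r.
exact: ABC.
Qed.

Section trajectory.
Context (R : realType) d (T : measurableType d) (P : probability T R).
Context (N n m p l : nat) (Par : set 'cV[R]_l).
Context (A : Par -> 'M[R]_n) (B : Par -> 'M[R]_(n, m)).
Context (F : Par -> 'M[R]_(n, p)).
Context (x0 : 'cV[R]_n) (lam : 'I_N -> Par) (u : 'I_N -> 'cV[R]_m).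
Context (w : 'I_N -> {RV P >-> 'cV[R]_p}) (Pw : probability 'cV[R]_p R).
Context (x : nat -> T -> 'cV[R]_n).
Hypothesis w_iid : iid_with_law w Pw.
Hypothesis Pwc : log_concave_on_convex Pw.
Hypothesis x_dpv : dpv_trajectory A B F x0 lam u w x.

Let joint_event (J : {set 'I_N}) (E : 'I_N -> set 'cV[R]_p) : set T :=
  \bigcap_(i in [set i | i \in J]) (w i @^-1` E i).

Let measurable_joint J E : (forall i, measurable (E i)) ->
  measurable (joint_event J E).
Proof.
move=> mE; apply: fin_bigcap_measurable => [|i _]; first exact: finite_finset.
exact: measurable_funPTI.
Qed.

(* Independence of the disturbances from time t on is carried along, which is
   what makes the next step a product law. *)
Lemma trajectory_law t : (t <= N)%N -> exists X : {mfun T >-> 'cV[R]_n},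
  [/\ x t = X, log_concave_on_convex (distribution P X) &
    forall D (J : {set 'I_N}) E, measurable D ->
      (forall i, measurable (E i)) -> (forall i, i \in J -> (t <= i)%N) ->
      P (X @^-1` D `&` joint_event J E) =
      (P (X @^-1` D) * P (joint_event J E))%E].
Proof.
elim: t => [_|t IH tN].
  have mx : measurable_fun setT (cst x0 : T -> 'cV[R]_n).
    exact: measurable_cst.
  have x0E : x 0%N = cst x0 by apply/funext => o; have [-> _] := x_dpv.
  have preE (D : set 'cV[R]_n) :
      (cst x0 : T -> 'cV[R]_n) @^-1` D = if x0 \in D then setT else set0.
    by rewrite preimage_cst.
  exists (mfun_Sub (mem_set mx)); split=> //=.
    apply: (@log_concave_on_convex_dirac _ _ x0) => D _.
    rewrite /distribution /pushforward /= preE diracE.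
    by case: ifPn; rewrite ?probability_setT ?measure0.
  move=> D J E _ mE _; rewrite preE; case: ifPn => _.
    by rewrite setTI probability_setT mul1e.
  by rewrite set0I measure0 mul0e.
have [X [xX Xc XE]] := IH (ltnW tN).
pose i0 : 'I_N := Ordinal tN.
pose L := A (lam i0); pose M := F (lam i0); pose b := B (lam i0) *m u i0.
have mg := measurable_affine_cV L M b.
have mXw : measurable_fun setT (fun o => (X o, w i0 o)).
  by apply/measurable_fun_pairP; split; exact: measurable_funPT.
have mx : measurable_fun setT (fun o => L *m X o + b + M *m w i0 o).
  exact: (measurableT_comp mg mXw).
have law D (J : {set 'I_N}) E : measurable D -> (forall i, measurable (E i)) ->
    (forall i, i \in J -> (t.+1 <= i)%N) ->
    P ((fun o => L *m X o + b + M *m w i0 o) @^-1` D `&` joint_event J E) =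
    ((distribution P X \x distribution P (w i0))%E
       [set vw | D (L *m vw.1 + b + M *m vw.2)%R] * P (joint_event J E))%E.
  move=> mD mE tJ.
  have mG : measurable
      [set vw : 'cV[R]_n * 'cV[R]_p | D (L *m vw.1 + b + M *m vw.2)].
    by rewrite -[X in measurable X]setTI; exact: mg.
  apply: (independent_pair_law (measurable_joint J mE) _ mG) => D1 D2 mD1 mD2.
  (* The current disturbance joins the later ones in a single joint event over [i0 |: J], whose
     indices are all at least [t], so the induction hypothesis splits off the state. Independence of
     the disturbances then splits off index [i0]. *)
  pose E' i := if i == i0 then D2 else E i.
  have mE' i : measurable (E' i) by rewrite /E'; case: ifPn.
  have i0J : i0 \notin J by apply/negP => /tJ; rewrite /= ltnn.
  have EE' : joint_event J E' = joint_event J E.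
    apply: eq_bigcapr => i /= iJ; rewrite /E'; case: eqP => // ii0.
    by move: iJ; rewrite ii0 (negPf i0J).
  have jointU : joint_event (i0 |: J) E' = w i0 @^-1` D2 `&` joint_event J E.
    rewrite -EE' /joint_event; apply/seteqP; split=> [s oJ|s [s2 oJ] i /=].
      split=> [|i iJ]; last by apply: oJ; rewrite /= in_setU1 iJ orbT.
      by have := oJ i0; rewrite /E' eqxx /= setU11; apply.
    by rewrite in_setU1 => /predU1P[->|iJ]; [rewrite /E' eqxx|exact: oJ].
  rewrite -setIA -jointU XE//; last first.
    by move=> i; rewrite in_setU1 => /predU1P[->|/tJ /ltnW].
  rewrite -muleA; congr (_ * _)%E.
  have [ind _] := w_iid.
  rewrite ind// big_setU1//= {1}/E' eqxx; congr (_ * _)%E.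
  by rewrite -EE' ind.
have lawT D : measurable D ->
    P ((fun o => L *m X o + b + M *m w i0 o) @^-1` D) =
    (distribution P X \x distribution P (w i0))%E
       [set vw | D (L *m vw.1 + b + M *m vw.2)].
  (* With no later disturbances the joint event is the whole space, leaving the law of the next
     state alone. *)
  move=> mD; have := law D finset.set0 (fun=> setT) mD (fun=> measurableT).
  rewrite (_ : joint_event _ _ = setT); last first.
    by apply/seteqP; split=> // o _ i.
  by rewrite setIT probability_setT mule1; apply=> i; rewrite inE.
exists (mfun_Sub (mem_set mx)); split=> /=.
- by apply/funext => o; have [_ /(_ i0 o)] := x_dpv; rewrite xX.
- move=> D1 D2 D3 z z01 mD1 mD2 mD3 cD1 cD2 D123.
  rewrite /distribution /pushforward /= !lawT//.
  have wc : log_concave_on_convex (distribution P (w i0)).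
    move=> C1 C2 C3 s s01 mC1 mC2 mC3 cC1 cC2 C123.
    by have [_ wE] := w_iid; rewrite !wE//; exact: Pwc.
  exact: (@log_concave_on_convex_affine _ _ _ _ _ _ L M b Xc wc _ _ _ _ z01).
- by move=> D J E mD mE tJ; rewrite law// lawT.
Qed.

End trajectory.

(** * Log-concavity of the occupancy function *)

Lemma log_mix_log_concave_fun (R : realType) (V : lmodType R) (f : V -> R) :
  (forall v, 0 <= f v) -> (forall z, 0 < z < 1 -> log_mix z f f f) ->
  log_concave_fun f.
Proof.
move=> f0 fc; split=> // v v' z /andP[]; rewrite le_eqVlt => /predU1P[<- _|z0].
  by rewrite mul0e add0e subr0 mul1e scale0r add0r scale1r.
rewrite le_eqVlt => /predU1P[->|z1].
  by rewrite subrr mul0e adde0 mul1e scale0r addr0 scale1r.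
have z1' : 0 < 1 - z by rewrite subr_gt0.
(* A vanishing value of [f] makes the left side -oo, because its weight is positive; otherwise
   logarithms of the multiplicative inequality are taken. *)
have [fv|] := leP (f v) 0.
  rewrite (@le0_lneNy _ (f v)%:E) ?lee_fin// gt0_muleNy ?lte_fin//.
  by rewrite addNye leNye.
have [fv'|fv' fv] := leP (f v') 0.
  rewrite (@le0_lneNy _ (f v')%:E) ?lee_fin// gt0_muleNy ?lte_fin//.
  by rewrite addeNy leNye.
have z01 : 0 < z < 1 by rewrite z0.
have pos : 0 < f v `^ z * f v' `^ (1 - z) by rewrite mulr_gt0// powR_gt0.
have H := fc z z01 v v'.
rewrite !lne_EFin// ?(lt_le_trans pos H)// -!EFinM -EFinD lee_fin.
rewrite -!ln_powR -lnM ?posrE ?powR_gt0// ler_ln ?posrE//.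
exact: lt_le_trans H.
Qed.

Theorem proposition2 (R : realType) (d : measure_display)
    (T : measurableType d) (P : probability T R)
    (N n m p l : nat)
    (N1 : (1 <= N)%N) (n1 : (1 <= n)%N) (m1 : (1 <= m)%N)
    (p1 : (1 <= p)%N) (l1 : (1 <= l)%N)
    (Par : set 'cV[R]_l) (Par_fin : finite_set Par)
    (A : Par -> 'M[R]_n) (B : Par -> 'M[R]_(n, m)) (F : Par -> 'M[R]_(n, p))
    (x0 : 'cV[R]_n) (lam : 'I_N -> Par) (u : 'I_N -> 'cV[R]_m)
    (w : 'I_N -> {RV P >-> 'cV[R]_p}) (Pw : probability 'cV[R]_p R)
    (w_iid : iid_with_law w Pw) (Pw_density : has_density Pw)
    (x : nat -> T -> 'cV[R]_n)
    (x_dpv : dpv_trajectory A B F x0 lam u w x)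
    (h : 'cV[R]_n -> R) (h_borel : measurable_fun setT h)
    (O_borel : measurable (obstacle h 0))
    (O_neq0 : lebesgue_cV R n (obstacle h 0) != 0%E)
    (Pw_log_concave : log_concave_measure Pw)
    (O_convex : convex_set (obstacle h 0)) :
  forall tau : nat, (1 <= tau <= N)%N ->
    log_concave_fun (occupancy P h x tau) /\
    forall alpha : R, convex_set (pr_occupy_set P h x alpha tau).
Proof.
move=> tau /andP[_ tauN].
have [X [xX Xc _]] :=
  trajectory_law w_iid (log_concave_measureW Pw_log_concave) x_dpv tauN.
(* The obstacle centres that cover [y]. This is the reflected translate y - O(0), so it inherits
   measurability and convexity from O(0). *)
pose K y := [set z | obstacle h z y].
have KE y z : K y z <-> obstacle h 0 (y - z) by rewrite /K /obstacle /= subr0.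
have mK y : measurable (K y).
  have mf : measurable_fun setT (fun z : 'cV[R]_n => y - z).
    apply/measurable_fun_mxP => i j; under eq_fun do rewrite !mxE.
    apply: measurable_funB => //; exact: measurable_mx_coord.
  rewrite (_ : K y = (fun z => y - z) @^-1` obstacle h 0).
    by rewrite -[X in measurable X]setTI; exact: mf.
  by apply/funext => z; apply/propext; exact: KE.
have mixE (y y' z z' : 'cV[R]_n) (t : R) :
    t *: y + (1 - t) *: y' - (t *: z + (1 - t) *: z') =
    t *: (y - z) + (1 - t) *: (y' - z').
  by rewrite !scalerBr opprD addrACA.
have Kmix y y' z z' (t : R) : 0 <= t <= 1 -> K y z -> K y' z' ->
    K (t *: y + (1 - t) *: y') (t *: z + (1 - t) *: z').
  move=> t01 /KE Oz /KE Oz'; apply/KE; rewrite mixE.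
  by move/convex_setP: O_convex; apply.
have cK y : convex_set (K y).
  apply/convex_setP => z z' t t01 Kz Kz'.
  have -> : y = t *: y + (1 - t) *: y by rewrite -scalerDl subrKC scale1r.
  exact: Kmix.
have occE y : (occupancy P h x tau y)%:E = distribution P X (K y).
  rewrite /occupancy xX fineK// fin_num_measure//.
  exact: (measurable_funPTI X (mK y)).
have occ0 y : 0 <= occupancy P h x tau y by rewrite fine_ge0.
have occ_mix z : 0 < z < 1 ->
    log_mix z (occupancy P h x tau) (occupancy P h x tau) (occupancy P h x tau).
  move=> z01 y y'; rewrite -lee_fin EFinM -!poweR_EFin !occE.
  apply: Xc => // a b Ka Kb; apply: Kmix => //.
  by have /andP[? ?] := z01; rewrite !ltW.
split; first exact: log_mix_log_concave_fun.
(* [superlevel_convex] needs a positive level; for [alpha] at most 0 the set is the whole space. *)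
move=> alpha; have [a0|a0] := leP alpha 0.
  apply/convex_setP => y y' z _ _ _; exact: le_trans (occ0 _).
exact: superlevel_convex.
Qed.
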